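(* Let $q$ and $d$ be integers such that (1) $q$ is a prime with $q \equiv 1 \pmod{16}$; (2) $d$ is nonzero, square-free, and not divisible by $q$; (3) $d$ is a square, but not a fourth power, modulo $q$; and (4) $q$ is a fourth power modulo $p$ for every odd prime $p$ dividing $d$. Then the system $$U^2 - qW^2 = dZ^2, \qquad UW = V^2$$ is locally solvable but not globally solvable: it has no nontrivial $\mathbb{Z}$-solutions $(U,V,W,Z)$.
   Context: A tuple is nontrivial if at least one coordinate is nonzero. A tuple of integers is primitive if the greatest common divisor of its entries is $1$; a primitive solution modulo $N$ of a system of equations is a primitive tuple of integers satisfying the corresponding congruences modulo $N$. A system of homogeneous equations with integer coefficients is $p$-locally solvable ($p$ a prime) if it has a primitive solution modulo $p^k$ for every $k\ge 1$. It is locally solvable if it is $p$-locally solvable for every prime $p$ and it has a nontrivial solution in $\mathbb{R}$. It is globally solvable if it has a nontrivial solution in $\mathbb{Z}$. *)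

(* Defs.v *)
From mathcomp Require Import all_boot all_order all_algebra.
From mathcomp Require Import reals.
From mathcomp Require Import mpoly.

Set Implicit Arguments.
Unset Strict Implicit.
Unset Printing Implicit Defensive.

Import Order.TTheory GRing.Theory Num.Theory.

Local Open Scope ring_scope.

Definition nontrivial (A : nmodType) (n : nat) (x : 'I_n -> A) : Prop :=
  exists i, x i != 0.

Definition primitive (n : nat) (x : 'I_n -> int) : Prop :=
  \big[gcdn/0%N]_(i < n) `|x i|%N = 1%N.

(* A system of equations [f = 0] is given by the list of its left-hand sides
   [f], which are meant to be homogeneous. *)
Definition eqn_system (n : nat) := seq {mpoly int[n]}.

Definition has_nontrivial_solution (A : comNzRingType) (n : nat)
    (S : eqn_system n) : Prop :=
  exists x : 'I_n -> A,
    nontrivial x /\ (forall f, f \in S -> mmap intr x f = 0).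

Definition p_locally_solvable (p n : nat) (S : eqn_system n) : Prop :=
  forall k : nat, (1 <= k)%N ->
    exists x : 'I_n -> int,
      primitive x /\
      (forall f, f \in S -> (f.@[x] = 0 %[mod (p ^ k)%N%:Z])%Z).

Definition locally_solvable (R : realType) (n : nat) (S : eqn_system n) :
    Prop :=
  (forall p : nat, prime p -> p_locally_solvable p S) /\
  has_nontrivial_solution R S.

Definition globally_solvable (n : nat) (S : eqn_system n) : Prop :=
  has_nontrivial_solution int S.

Definition square_free (d : int) : Prop :=
  forall m : int, (m ^+ 2 %| d)%Z -> `|m|%N = 1%N.

Definition is_power_mod (n : nat) (a m : int) : Prop :=
  exists x : int, (x ^+ n = a %[mod m])%Z.

(* The variables 'X_0, 'X_1, 'X_2, 'X_3 stand for U, V, W, Z in this order. *)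
Definition UVWZ_system (q d : int) : eqn_system 4 :=
  let U : {mpoly int[4]} := 'X_(inord 0) in
  let V : {mpoly int[4]} := 'X_(inord 1) in
  let W : {mpoly int[4]} := 'X_(inord 2) in
  let Z : {mpoly int[4]} := 'X_(inord 3) in
  [:: U ^+ 2 - q *: W ^+ 2 - d *: Z ^+ 2; U * W - V ^+ 2].

Lemma UVWZ_system_homog (q d : int) :
  all (fun f : {mpoly int[4]} => f \is 2.-homog) (UVWZ_system q d).
Proof.
have h1 (i : 'I_4) : ('X_i : {mpoly int[4]}) \is 1.-homog.
  by rewrite dhomogX /= mdeg1.
have hX (i j : 'I_4) : ('X_i * 'X_j : {mpoly int[4]}) \is 2.-homog.
  exact: (dhomogM (h1 i) (h1 j)).
by rewrite /= !expr2 !rpredB ?rpredZ ?hX.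
Qed.

Lemma UVWZ_system_solution (A : comNzRingType) (q d : int) (x : 'I_4 -> A) :
  let U := x (inord 0) in let V := x (inord 1) in
  let W := x (inord 2) in let Z := x (inord 3) in
  (forall f, f \in UVWZ_system q d -> mmap intr x f = 0) <->
  U ^+ 2 - q%:~R * W ^+ 2 = d%:~R * Z ^+ 2 /\ U * W = V ^+ 2.
Proof.
move=> U V W Z; have hX i : mmap intr x 'X_i = x i by rewrite mmapX mmap1U.
have e1 : mmap intr x (nth 0 (UVWZ_system q d) 0) =
    U ^+ 2 - q%:~R * W ^+ 2 - d%:~R * Z ^+ 2.
  by rewrite /= !rmorphB /= !mmapZ !rmorphXn /= !hX.
have e2 : mmap intr x (nth 0 (UVWZ_system q d) 1) = U * W - V ^+ 2.
  by rewrite /= rmorphB /= rmorphXn rmorphM /= !hX.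
split=> [h | [h1 h2] f].
  split; apply/eqP; rewrite -subr_eq0.
    by rewrite -e1 h // mem_head.
  by rewrite -e2 h // in_cons mem_head orbT.
rewrite !inE => /orP[] /eqP ->.
  by rewrite [LHS]e1 h1 subrr.
by rewrite [LHS]e2 h2 subrr.
Qed.

(* Main.v *)
(* A global solution with U <> 0 gives, after multiplication by U^2, an equation
   u^4 - q w^4 = d z^2 with u, w coprime.  Each odd prime p dividing z then has q
   as a square modulo p, so p is a square modulo q by reciprocity; as -1 and 2 are
   squares modulo q too, z is a square modulo q, and d = u^4 / z^2 would be a
   fourth power.  Locally, at q the point U^2 = d Z^2 (with W = 0) lifts, and when
   q is a p-adic fourth power there is a solution with Z = 0, which covers 2 and
   the divisors of d.  At any other p, the curve has a point modulo p; if d and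
   -qd are nonsquares then -q is a square, and one concludes by sums of two
   squares if -1 is a nonsquare, and otherwise by a pigeonhole argument
   replacing the Hasse-Weil bound for the genus one curve. *)

Require Import Defs.
From mathcomp Require Import all_boot all_order all_algebra.
From mathcomp Require Import all_fingroup all_solvable all_field.
From mathcomp Require Import reals.
From mathcomp Require Import mpoly.
From mathcomp Require Import ring zify.

Set Implicit Arguments.
Unset Strict Implicit.
Unset Printing Implicit Defensive.

Import Order.TTheory GRing.Theory Num.Theory.

Local Open Scope ring_scope.

(** * Squares and quartics over finite fields *)

Definition is_square (F : finFieldType) (x : F) := [exists y, y ^+ 2 == x].

Lemma is_squareP (F : finFieldType) (x : F) :
  reflect (exists y, x = y ^+ 2) (is_square x).
Proof.
by apply: (iffP existsP) => -[y e]; exists y; [rewrite (eqP e) | rewrite e].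
Qed.

Lemma is_square_sqr (F : finFieldType) (x : F) : is_square (x ^+ 2).
Proof. by apply/is_squareP; exists x. Qed.

Lemma is_square0 (F : finFieldType) : is_square (0 : F).
Proof. by apply/is_squareP; exists 0; rewrite expr0n. Qed.

Lemma is_square1 (F : finFieldType) : is_square (1 : F).
Proof. by apply/is_squareP; exists 1; rewrite expr1n. Qed.

Lemma is_squareM (F : finFieldType) (x y : F) :
  is_square x -> is_square y -> is_square (x * y).
Proof.
by move=> /is_squareP[a ->] /is_squareP[b ->]; rewrite -exprMn is_square_sqr.
Qed.

Lemma is_squareV (F : finFieldType) (x : F) : is_square x^-1 = is_square x.
Proof.
have h (y : F) : is_square y -> is_square y^-1.
  by move=> /is_squareP[a ->]; rewrite -exprVn is_square_sqr.
by apply/idP/idP => /h; rewrite ?invrK.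
Qed.

Lemma is_squareMl (F : finFieldType) (x y : F) :
  x != 0 -> is_square x -> is_square (x * y) = is_square y.
Proof.
move=> x0 sx; apply/idP/idP => [h|]; last exact: is_squareM.
by rewrite -[y](mulKf x0) is_squareM // is_squareV.
Qed.

(** The unit group is cyclic and every nonsquare is an odd power of a generator, so the exponents of
    two nonsquares add up to an even one. *)
Lemma nonsquareM (F : finFieldType) (x y : F) :
  ~~ is_square x -> ~~ is_square y -> is_square (x * y).
Proof.
have [g defG] := cyclicP (field_unit_group_cyclic [set: {unit F}]%G).
have gen (z : F) : ~~ is_square z -> exists i, z = FinRing.uval g ^+ i.*2.+1.
  move=> nz; have z0 : z != 0.
    by apply: contraNneq nz => ->; rewrite is_square0.
  have uz : z \is a GRing.unit by rewrite unitfE.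
  have : FinRing.Unit uz \in <[g]>%g by rewrite -defG inE.
  case/cycleP => i /(congr1 val); rewrite FinRing.val_unitX /= => ez.
  exists i./2; rewrite ez -[in LHS](odd_double_half i); congr (_ ^+ _).
  case oi: (odd i) => //; move: nz.
  by rewrite ez -(odd_double_half i) oi -muln2 exprM is_square_sqr.
move=> /gen[i ->] /gen[j ->]; rewrite -exprD addSn addnS -doubleD -doubleS.
by rewrite -muln2 exprM is_square_sqr.
Qed.

(** If every element had a root, a choice [f] of roots would be injective, hence onto by finiteness;
    squaring would then be injective, although 1 and -1 have the same square. *)
Lemma nonsquare_exists (F : finFieldType) :
  2%:R != 0 :> F -> exists x : F, ~~ is_square x.
Proof.
move=> two; apply/existsP; apply: contraT; rewrite negb_exists => /forallP h.
have /fin_all_exists[f fE] : forall x : F, exists y, y ^+ 2 == x.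
  by move=> x; apply/existsP; move: (h x); rewrite negbK.
have finj : injective f.
  by move=> x y e; rewrite -(eqP (fE x)) e (eqP (fE y)).
have onef : forall y, exists x, y = f x.
  by move=> y; have /codomP[x] := injF_onto finj y; exists x.
have [a ea] := onef 1; have [b eb] := onef (-1).
have eab : a = b by rewrite -(eqP (fE a)) -(eqP (fE b)) -ea -eb sqrrN.
move: two; suff -> : 2%:R = 0 :> F by rewrite eqxx.
by rewrite -[2%:R]/(1 + 1) {1}ea eab -eb addNr.
Qed.

(* [-1] is the sum [1 + ... + 1] with [p - 1] terms. *)
Lemma is_square_opp1 (F : finFieldType) :
  (forall a : F, is_square a -> is_square (1 + a)) -> is_square (-1 : F).
Proof.
move=> h; have [p p_pr pF] := finPcharP F.
have sq n : is_square (n%:R : F).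
  by elim: n => [|n IH]; [rewrite is_square0 | rewrite -natr1 addrC h].
suff -> : -1 = p.-1%:R :> F by [].
apply/eqP; rewrite eq_sym -subr_eq0 opprK natr1 prednK ?prime_gt0 //.
by rewrite -(dvdn_pcharf pF).
Qed.

(* If all these values were squares [y ^+ 2], they would be nonzero, and a choice
   of roots [y] odd in [x] would make [x |-> y + i * s * x ^+ 2] injective, as
   this has inverse [y - i * s * x ^+ 2]; but it omits the value 0. *)
Lemma quartic_nonsquare (F : finFieldType) (i s : F) :
  2%:R != 0 :> F -> i ^+ 2 = -1 -> ~~ is_square s ->
  exists x, ~~ is_square (1 - s ^+ 2 * x ^+ 4).
Proof.
move=> two i2 ns.
have [/existsP//|] := boolP [exists x, ~~ is_square (1 - s ^+ 2 * x ^+ 4)].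
rewrite negb_exists => /forallP h; exfalso.
have s0 : s != 0.
  by apply: contraNneq ns => ->; rewrite is_square0.
have i0 : i != 0.
  by apply: contra_eq_neq i2 => ->; rewrite expr0n /= eq_sym oppr_eq0 oner_eq0.
have sqN (a : F) : is_square a -> is_square (- a).
  move=> sa; have -> : - a = i ^+ 2 * a by rewrite i2 mulN1r.
  by rewrite is_squareM ?is_square_sqr.
(* A zero would equate [s] times a nonzero square, which is a nonsquare, with 1 or -1, both
   squares. *)
have nz x : 1 - s ^+ 2 * x ^+ 4 != 0.
  have [->|x0] := eqVneq x 0; first by rewrite expr0n mulr0 subr0 oner_neq0.
  have -> : 1 - s ^+ 2 * x ^+ 4 = (1 - s * x ^+ 2) * (1 + s * x ^+ 2) by ring.
  have sx (c : F) : s * x ^+ 2 = c -> ~~ is_square c.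
    by move=> <-; rewrite mulrC is_squareMl ?is_square_sqr ?expf_neq0.
  rewrite mulf_neq0 // ?subr_eq0 ?addr_eq0.
    by rewrite eq_sym; apply/eqP => /sx; rewrite is_square1.
  rewrite -eqr_oppLR eq_sym; apply/eqP => /sx; rewrite sqN //.
  by rewrite is_square1.
(* A root of the form [x * g (x ^+ 2)] is odd in [x]. *)
have gE X : exists g,
    [forall x, (x ^+ 2 == X) && (x != 0) ==>
       ((x * g) ^+ 2 == 1 - s ^+ 2 * x ^+ 4)].
  have [/existsP[x /andP[/eqP xX x0]]|] := boolP [exists x, (x ^+ 2 == X) && (x != 0)].
    have /is_squareP[y ey] : is_square (1 - s ^+ 2 * x ^+ 4).
      by rewrite -[is_square _]negbK h.
    exists (y / x); apply/forallP => z; apply/implyP => /andP[/eqP zX z0].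
    rewrite exprMn exprMn zX -xX exprVn mulrCA mulfV ?expf_neq0 // mulr1 -ey.
    by rewrite -[4%N]/(2 * 2)%N !exprM zX xX.
  rewrite negb_exists => /forallP hX; exists 0; apply/forallP => x.
  by rewrite (negbTE (hX x)).
have /fin_all_exists[g hg] := gE.
have gP x : x != 0 -> (x * g (x ^+ 2)) ^+ 2 = 1 - s ^+ 2 * x ^+ 4.
  by move=> x0; have /forallP/(_ x) := hg (x ^+ 2); rewrite eqxx x0 => /eqP.
(* The value at 0 is set apart: [x * g (x ^+ 2)] vanishes there, while a root of 1 is needed. *)
pose y x := if x == 0 then 1 else x * g (x ^+ 2).
have yP x : y x ^+ 2 = 1 - s ^+ 2 * x ^+ 4.
  rewrite /y; case: eqVneq => [->|/gP//].
  by rewrite expr1n expr0n mulr0 subr0.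
pose t x := y x + i * s * x ^+ 2.
have tV x : t x * (y x - i * s * x ^+ 2) = 1.
  have -> : t x * (y x - i * s * x ^+ 2) = y x ^+ 2 - i ^+ 2 * s ^+ 2 * x ^+ 4.
    by rewrite /t; ring.
  by rewrite yP i2; ring.
have tinj : injective t.
  move=> x x' e.
  have t0 : t x != 0.
    by apply: contra_eq_neq (tV x) => ->; rewrite mul0r eq_sym oner_neq0.
  have e' : y x - i * s * x ^+ 2 = y x' - i * s * x' ^+ 2.
    by apply: (mulfI t0); rewrite tV e tV.
  have : 2%:R * i * s * (x ^+ 2 - x' ^+ 2) = 0.
    have -> : 2%:R * i * s * (x ^+ 2 - x' ^+ 2) =
      (t x - (y x - i * s * x ^+ 2)) - (t x' - (y x' - i * s * x' ^+ 2)).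
      by rewrite /t; ring.
    by rewrite e e' subrr.
  move/eqP; rewrite !mulf_eq0 (negbTE two) (negbTE i0) (negbTE s0) /= subr_eq0.
  move=> /eqP ex2; move: e; rewrite /t ex2 => /addIr ey.
  move/eqP: ex2; rewrite eqf_sqr => /orP[/eqP //|/eqP exN].
  have [x'0|x'0] := eqVneq x' 0; first by rewrite exN x'0 oppr0.
  have yN : y x = - y x'.
    by rewrite /y exN oppr_eq0 (negbTE x'0) sqrrN mulNr.
  have y0 : 2%:R * y x' = 0.
    rewrite mulr_natl mulr2n -{1}ey yN addNr //.
  move/eqP: y0; rewrite mulf_eq0 (negbTE two) /= => /eqP y0.
  by have := nz x'; rewrite -yP y0 expr0n eqxx.
have /codomP[x ex] := injF_onto tinj 0.
by have := tV x; rewrite -ex mul0r => /eqP; rewrite eq_sym oner_eq0.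
Qed.

(** The last two alternatives are points of the system with [(U, V, W)] equal to [(1, x, x ^+ 2)] or
    [(x ^+ 2, x, 1)]; the first gives a point with [Z = 0]. When [d] is a nonsquare, any nonsquare
    value of the quartic is [d] times a square. *)
Lemma quartic_points (F : finFieldType) (q d : F) :
  2%:R != 0 :> F -> q != 0 -> d != 0 ->
  [\/ exists x, x ^+ 4 = q, exists x z, 1 - q * x ^+ 4 = d * z ^+ 2
    | exists x z, x ^+ 4 - q = d * z ^+ 2].
Proof.
move=> two q0 d0.
have div_d (a : F) : is_square (a * d) -> exists z, a = d * z ^+ 2.
  move=> /is_squareP[y ey]; exists (y / d).
  by rewrite exprMn exprVn -ey; field.
have [sd|nd] := boolP (is_square d).
  have [|z ez] := div_d 1; first by rewrite mul1r.
  by apply: Or32; exists 0, z; rewrite expr0n mulr0 subr0.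
have [sqd|nqd] := boolP (is_square (- q * d)).
  by have [z ez] := div_d _ sqd; apply: Or33; exists 0, z; rewrite expr0n sub0r.
have nonsq (a : F) : ~~ is_square a -> exists z, a = d * z ^+ 2.
  by move=> na; apply: div_d; apply: nonsquareM.
have sq : is_square (- q).
  apply: contraNT nqd => nq; exact: nonsquareM.
(* If -1 is a nonsquare, one of [r] and [- r] is a square for each [r], so every square is a fourth
   power. With [- q = v ^+ 4] and [x = w / v], the quartic takes the value [1 + b ^+ 2]. *)
have [s1|n1] := boolP (is_square (-1 : F)); last first.
  have [r er] := is_squareP _ sq.
  have [v ev] : exists v, - q = v ^+ 4.
    have [/is_squareP[v ev]|nr] := boolP (is_square r).
      by exists v; rewrite er ev -exprM.
    have /is_squareP[v ev] := nonsquareM n1 nr.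
    by exists v; rewrite er -[4%N]/(2 * 2)%N exprM -ev mulN1r sqrrN.
  have v0 : v != 0.
    by apply: contraNneq q0 => v0; rewrite -oppr_eq0 ev v0 expr0n.
  have [/existsP[a]|] := boolP [exists a : F, is_square a && ~~ is_square (1 + a)].
    case/andP => /is_squareP[b ->] nb.
    have [w ew] : exists w, b ^+ 2 = w ^+ 4.
      have [/is_squareP[w ->]|nbb] := boolP (is_square b).
        by exists w; rewrite -exprM.
      have /is_squareP[w ew] := nonsquareM n1 nbb.
      by exists w; rewrite -[4%N]/(2 * 2)%N exprM -ew mulN1r sqrrN.
    have [z ez] := nonsq _ nb.
    apply: Or32; exists (w / v), z; rewrite -ez ew -mulNr ev; field.
    exact: v0.
  rewrite negb_exists => /forallP h; case/negP: n1; apply: is_square_opp1 => a sa.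
  by have := h a; rewrite sa /= negbK.
have /is_squareP[i ei] := s1.
have /is_squareP[s es] : is_square q by rewrite -[q]opprK -mulN1r is_squareM.
have [/is_squareP[x ex]|ns] := boolP (is_square s).
  by apply: Or31; exists x; rewrite es ex -exprM.
have [x nx] := quartic_nonsquare two (esym ei) ns.
have [z ez] := nonsq _ nx.
by apply: Or32; exists x, z; rewrite es.
Qed.

(** * Gauss sums and quadratic reciprocity *)

(** The values lie in [int] so that the quadratic character can be mapped into whichever field
    contains the additive character. *)
Definition quadchar (F : finFieldType) (x : F) : int :=
  if x == 0 then 0 else if is_square x then 1 else -1.

Lemma quadcharM (F : finFieldType) (x y : F) :
  quadchar (x * y) = quadchar x * quadchar y.
Proof.
rewrite /quadchar mulf_eq0; case: eqVneq => [_|x0] /=; first by rewrite mul0r.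
case: eqVneq => [_|y0] /=; first by rewrite mulr0.
have [sx|nx] := boolP (is_square x); first by rewrite is_squareMl // mul1r.
have [sy|ny] := boolP (is_square y).
  by rewrite mulrC is_squareMl // (negbTE nx).
by rewrite nonsquareM.
Qed.

Lemma quadchar_sqr (F : finFieldType) (x : F) : x != 0 -> quadchar (x ^+ 2) = 1.
Proof. by move=> x0; rewrite /quadchar is_square_sqr expf_eq0 (negbTE x0). Qed.

(** Multiplying the index by a nonsquare permutes [F] and changes the sign of every term. *)
Lemma sum_quadchar (F : finFieldType) :
  2%:R != 0 :> F -> \sum_(x : F) quadchar x = 0.
Proof.
move=> /nonsquare_exists[g ng].
have g0 : g != 0 by apply: contraNneq ng => ->; rewrite is_square0.
have : \sum_(x : F) quadchar x = - \sum_(x : F) quadchar x.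
  rewrite {1}(reindex_inj (mulfI g0)) -sumrN; apply: eq_bigr => x _.
  by rewrite quadcharM {1}/quadchar (negbTE g0) (negbTE ng) mulN1r.
lia.
Qed.

Section GaussSum.
Variables (F : finFieldType) (K : fieldType) (e : F -> K).
Hypotheses (two : 2%:R != 0 :> F).
Hypotheses (eD : {morph e : x y / x + y >-> x * y}).
Hypotheses (e0 : e 0 = 1) (e_neq1 : exists a, e a != 1).

(** Here [e] is a nontrivial additive character. Translating the index by some [a] with [e a != 1]
    multiplies the full sum by [e a], so this sum vanishes. *)
Lemma sum_addchar (c : F) : \sum_a e (a * c) = if c == 0 then #|F|%:R else 0.
Proof.
case: eqVneq => [->|c0].
  by under eq_bigr do rewrite mulr0 e0; rewrite sumr_const.
rewrite -(reindex_inj (mulIf c0) (P := predT) (F := e)) /=.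
have [a ea] := e_neq1.
have : e a * (\sum_a e a) = \sum_a e a.
  rewrite big_distrr /= [RHS](reindex_inj (addrI a)).
  by apply: eq_bigr => b _; rewrite eD.
move=> /eqP; rewrite -[X in _ == X]mul1r -subr_eq0 -mulrBl mulf_eq0.
by rewrite subr_eq0 (negbTE ea) => /eqP.
Qed.

Definition gauss_sum : K := \sum_a (quadchar a)%:~R * e a.

(* Substituting [b = a * c] in the double sum over [a] and [b] separates the
   variables, up to the terms with [a = 0]. *)
Lemma gauss_sum_sqr : gauss_sum ^+ 2 = (quadchar (-1 : F))%:~R * #|F|%:R.
Proof.
have -> : gauss_sum ^+ 2 =
    \sum_a \sum_c (quadchar (a ^+ 2 * c))%:~R * e (a * (1 + c)).
  rewrite expr2 {1}/gauss_sum big_distrl; apply: eq_bigr => a _ /=.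
  have [->|a0] := eqVneq a 0.
    rewrite {1}/quadchar eqxx !mul0r big1 // => c _.
    by rewrite expr0n !mul0r /quadchar eqxx mul0r.
  rewrite /gauss_sum (reindex_inj (mulfI a0)) big_distrr; apply: eq_bigr => c _ /=.
  rewrite mulrACA -rmorphM -quadcharM -eD mulrA -expr2; congr (_ * e _).
  by ring.
rewrite exchange_big /=.
have -> : \sum_c \sum_a (quadchar (a ^+ 2 * c))%:~R * e (a * (1 + c)) =
    \sum_c (quadchar c)%:~R * (\sum_a e (a * (1 + c)) - 1).
  apply: eq_bigr => c _; rewrite [in LHS](bigD1 0) // [in RHS](bigD1 0) //=.
  rewrite expr0n !mul0r e0 [_ + _ - 1]addrC addKr /quadchar eqxx mul0r add0r.
  rewrite big_distrr; apply: eq_bigr => a a0.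
  by rewrite -!/(quadchar _) quadcharM quadchar_sqr // mul1r.
under eq_bigr do rewrite mulrBr mulr1.
rewrite sumrB -rmorph_sum sum_quadchar // subr0 (bigD1 (-1)) //= sum_addchar subrr eqxx.
rewrite big1 ?addr0 // => c c1; rewrite sum_addchar addrC addr_eq0 (negbTE c1).
by rewrite mulr0.
Qed.

(** The Frobenius of [K] fixes the integer coefficients and sends [e a] to [e (p%:R * a)];
    reindexing by [p] then extracts the character value. *)
Lemma gauss_sum_frobenius (p : nat) :
  p \in [pchar K] -> odd p -> p%:R != 0 :> F ->
  gauss_sum ^+ p = (quadchar (p%:R : F))%:~R * gauss_sum.
Proof.
move=> pK odd_p p0; have eX a n : e a ^+ n = e (n%:R * a).
  elim: n => [|n IH]; first by rewrite mul0r e0.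
  by rewrite exprS IH -eD -natr1 addrC mulrDl mul1r addrC.
rewrite -(pFrobenius_autE pK) {1}/gauss_sum rmorph_sum /=.
rewrite /gauss_sum [in RHS](reindex_inj (mulfI p0)) big_distrr; apply: eq_bigr => a _ /=.
rewrite rmorphM /= pFrobenius_aut_int pFrobenius_autE eX mulrA -rmorphM quadcharM mulrA.
by rewrite -quadcharM -expr2 quadchar_sqr // mul1r.
Qed.

(** The Gauss sum is [r] or [- r], so the Frobenius fixes it. By [gauss_sum_frobenius] the character
    of [p] must be 1, since neither the sum nor 2 vanishes in [K]. *)
Lemma quadchar_gauss (p : nat) :
  p \in [pchar K] -> odd p -> p%:R != 0 :> F -> is_square (-1 : F) ->
  #|F|%:R != 0 :> K -> (exists r : nat, r%:R ^+ 2 = #|F|%:R :> K) ->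
  is_square (p%:R : F).
Proof.
move=> pK odd_p p0 s1 nF [r er].
have nz1 : -1 != 0 :> F by rewrite oppr_eq0 oner_eq0.
have G2 : gauss_sum ^+ 2 = r%:R ^+ 2.
  by rewrite gauss_sum_sqr /quadchar s1 (negbTE nz1) mul1r er.
have G0 : gauss_sum != 0.
  by apply: contraNneq nF => g0; rewrite -er -G2 g0 expr0n.
have := gauss_sum_frobenius pK odd_p p0.
have -> : gauss_sum ^+ p = gauss_sum.
  move/eqP: G2; rewrite -(pFrobenius_autE pK) eqf_sqr => /orP[]/eqP->.
    by rewrite pFrobenius_aut_nat.
  by rewrite pFrobenius_autN pFrobenius_aut_nat.
rewrite /quadchar (negbTE p0); case: ifP => // _ eG.
have two0 : 2%:R != 0 :> K.
  rewrite -(dvdn_pcharf pK) dvdn_prime2 ?(pcharf_prime pK) //.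
  by apply: contraTneq odd_p => ->.
have : 2%:R * gauss_sum = 0 by rewrite mulr_natl mulr2n {1}eG mulN1r addNr.
by move=> /eqP; rewrite mulf_eq0 (negbTE two0) (negbTE G0).
Qed.

End GaussSum.

(** A suitable power of a generator of the unit group has order [n.*2]; its [n]-th power is a square
    root of 1 other than 1. *)
Lemma expr_opp1_exists (F : finFieldType) (n : nat) :
  (n.*2 %| #|F|.-1)%N -> exists x : F, x ^+ n = -1.
Proof.
move=> dn; have F1 : (0 < #|F|.-1)%N by rewrite -card_finField_unit cardG_gt0.
have n0 : (0 < n)%N by rewrite -double_gt0 (dvdn_gt0 F1).
have [g defG] := cyclicP (field_unit_group_cyclic [set: {unit F}]%G).
have og : #[g]%g = #|F|.-1 by rewrite -card_finField_unit defG.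
move: dn => /dvdnP[m em].
have m0 : (0 < m)%N by case: (m) F1 em => // F1 em; rewrite em in F1.
pose x := FinRing.uval (g ^+ m)%g.
have ex k : (x ^+ k == 1) = (n.*2 %| k)%N.
  rewrite /x -FinRing.val_unitX -[1]/(FinRing.uval 1%g) (inj_eq val_inj).
  by rewrite -expgM -order_dvdn og em dvdn_pmul2l.
exists x; have : (x ^+ n) ^+ 2 == 1 by rewrite -exprM ex muln2.
rewrite sqrf_eq1 ex => /orP[|/eqP //].
by rewrite gtnNdvd // -addnn -[X in (X < _)%N]addn0 ltn_add2l.
Qed.


Lemma is_square_opp1_mod4 (q : nat) :
  prime q -> (q = 1 %[mod 4])%N -> is_square (-1 : 'F_q).
Proof.
move=> pq q1; have [x x2] : exists x : 'F_q, x ^+ 2 = -1.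
  apply: expr_opp1_exists.
  by rewrite card_Fp // -subn1 -eqn_mod_dvd ?prime_gt0 //; apply/eqP.
by rewrite -x2 is_square_sqr.
Qed.

(** The Gauss sum of ['F_q] is formed in the field with [p ^ q.-1] elements: by Fermat [q] divides
    the order of its unit group, which thus contains an element [z] of order [q], and [z] yields the
    additive character. *)
Lemma quadratic_reciprocity_mod4 (p q : nat) : prime p -> prime q -> odd p -> p != q ->
  (q = 1 %[mod 4])%N ->
  is_square (q%:R : 'F_p) -> is_square (p%:R : 'F_q).
Proof.
move=> pp pq odd_p npq q1 /is_squareP[r er].
have q1_gt0 : (0 < q.-1)%N by rewrite -subn1 subn_gt0 prime_gt1.
have [K pK cK] := PrimePowerField pp q1_gt0.
have q0 : q%:R != 0 :> K by rewrite -(dvdn_pcharf pK) dvdn_prime2.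
have [z z1 zq] : exists2 z : K, z != 1 & z ^+ q = 1.
  have dq : (q %| #|[set: {unit K}]|)%N.
    rewrite card_finField_unit cK -subn1 -eqn_mod_dvd ?expn_gt0 ?prime_gt0 //.
    rewrite -(totient_prime pq); apply/eqP/Euler_exp_totient.
    by rewrite prime_coprime // dvdn_prime2.
  have [u _ ou] := Cauchy (G := [set: {unit K}]%G) pq dq.
  exists (FinRing.uval u).
    apply: contraTneq (prime_gt1 pq) => u1.
    have -> : q = 1%N by rewrite -ou; apply/eqP; rewrite order_eq1; apply/eqP/val_inj.
    by [].
  by rewrite -FinRing.val_unitX -ou expg_order.
pose e (a : 'F_q) := z ^+ (a : nat).
have eN n : e n%:R = z ^+ n by rewrite /e val_Fp_nat // expr_mod.
apply: (@quadchar_gauss _ K e) => //.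
- rewrite -(dvdn_pcharf (pchar_Fp pq)) dvdn_prime2 //; apply/eqP => q2.
  by move: q1; rewrite q2.
- by move=> a b; rewrite -[a in LHS]natr_Zp -[b in LHS]natr_Zp -natrD eN exprD.
- by exists 1; rewrite -[1]/(1%:R) eN expr1.
- by rewrite -(dvdn_pcharf (pchar_Fp pq)) dvdn_prime2 // eq_sym.
- exact: is_square_opp1_mod4.
- by rewrite card_Fp.
(* The equation [r ^+ 2 = q] in ['F_p] is a divisibility by [p] in [int], so it carries over to [K],
   also of characteristic [p]. *)
rewrite card_Fp //; exists (r : nat); apply/eqP.
rewrite -natrX -subr_eq0.
have /eqP : (r : nat)%:R ^+ 2 - q%:R = 0 :> 'F_p by rewrite natr_Zp er subrr.
rewrite -natrX.
have := dvdz_pcharf pK ((r ^ 2)%N%:Z - q%:Z); rewrite rmorphB /= => <-.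
by have := dvdz_pcharf (pchar_Fp pp) ((r ^ 2)%N%:Z - q%:Z); rewrite rmorphB /= => <-.
Qed.

(** If [x] is a primitive eighth root of unity, [x + x^-1] is a square root of 2. *)
Lemma is_square_two (q : nat) : prime q -> (q = 1 %[mod 8])%N -> is_square (2%:R : 'F_q).
Proof.
move=> pq q1; have [x x4] : exists x : 'F_q, x ^+ 4 = -1.
  apply: expr_opp1_exists.
  by rewrite card_Fp // -subn1 -eqn_mod_dvd ?prime_gt0 //; apply/eqP.
have x0 : x != 0.
  by apply: contra_eq_neq x4 => ->; rewrite expr0n eq_sym oppr_eq0 oner_eq0.
apply/is_squareP; exists (x + x^-1).
have -> : (x + x^-1) ^+ 2 = 2%:R + x^-1 ^+ 2 * (x ^+ 4 + 1) by field.
by rewrite x4 addNr mulr0 addr0.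
Qed.

(** * Hensel lifting and local solutions *)

(** Leaving the coefficient of [h ^+ 2] unspecified avoids dividing the second derivative by 2. *)
Lemma horner_taylor1 (R : comNzRingType) (f : {poly R}) (y h : R) :
  exists c, f.[y + h] = f.[y] + f^`().[y] * h + c * h ^+ 2.
Proof.
elim/poly_ind: f => [|f a [c ec]].
  by exists 0; rewrite deriv0 !horner0; ring.
exists (f^`().[y] + c * (y + h)).
rewrite derivD derivM derivX derivC mulr1 addr0.
rewrite !(hornerD, hornerM, hornerX, hornerC) ec; ring.
Qed.

(** The derivative has valuation exactly [m] at [y]. Each Newton step gains one power of [p] in the
    value of [f] and preserves this valuation. *)
Lemma hensel (p m : nat) (f : {poly int}) (y c : int) :
  prime p -> (p%:Z ^+ m.*2.+1 %| f.[y])%Z ->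
  f^`().[y] = p%:Z ^+ m * c -> ~~ (p%:Z %| c)%Z ->
  forall k, exists z, (p%:Z ^+ k %| f.[z])%Z.
Proof.
move=> pp fy f'y nc k.
have lift j : exists z, (p%:Z ^+ (m.*2 + j).+1 %| f.[z])%Z /\
    exists2 c, f^`().[z] = p%:Z ^+ m * c & ~~ (p%:Z %| c)%Z.
  elim: j => [|j [z [/dvdzP[b eb] [a ea na]]]].
    by exists y; rewrite addn0; split=> //; exists c.
  have /coprimezP[[u v] /= euv] : coprimez a p%:Z.
    by rewrite coprimez_sym coprimezE prime_coprime.
  (* Newton's correction, minus the value of [f] over that of its derivative, with [u] as inverse of
     [a] modulo [p]. *)
  pose h : int := - b * u * p%:Z ^+ (m + j).+1.
  have hE : h = - b * u * (p%:Z * p%:Z ^+ m * p%:Z ^+ j).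
    by rewrite /h exprS exprD mulrA.
  have [r er] := horner_taylor1 f z h; have [s es] := horner_taylor1 f^`() z h.
  exists (z + h); split.
    apply/dvdzP; exists (b * v + r * (b * u) ^+ 2 * p%:Z ^+ j).
    have -> : p%:Z ^+ (m.*2 + j.+1).+1 =
        p%:Z ^+ 2 * (p%:Z ^+ m) ^+ 2 * p%:Z ^+ j.
      by rewrite -exprM -!exprD; congr (_ ^+ _); lia.
    rewrite er eb ea hE exprS exprD -muln2 exprM.
    (* The part [b * u * a] cancels against the linear term of the correction; the rest has an extra
       factor [p]. *)
    have {1}-> : b = b * (u * a + v * p%:Z) by rewrite euv mulr1.
    ring.
  exists (a + p%:Z * (p%:Z ^+ j * (- b * u) * (f^`()^`().[z] + s * h))).
    rewrite es ea expr2 hE; ring.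
  by rewrite rpredDr // dvdz_mulr.
have [z [fz _]] := lift k; exists z; apply: dvdz_trans fz.
by apply: dvdz_exp2l; lia.
Qed.

Lemma Euclid_dvdzM (p : nat) (m n : int) :
  prime p -> (p%:Z %| m * n)%Z = (p%:Z %| m)%Z || (p%:Z %| n)%Z.
Proof. by move=> pp; rewrite !dvdzE abszM Euclid_dvdM. Qed.

Lemma Euclid_dvdzX (p n : nat) (m : int) :
  prime p -> (p%:Z %| m ^+ n)%Z = (p%:Z %| m)%Z && (0 < n)%N.
Proof. by move=> pp; rewrite !dvdzE abszX Euclid_dvdX. Qed.

Lemma hensel_power (p n : nat) (a b x : int) :
  prime p -> (0 < n)%N -> ~~ (p %| n)%N -> ~~ (p%:Z %| a)%Z -> ~~ (p%:Z %| b)%Z ->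
  (p%:Z %| a * x ^+ n - b)%Z ->
  forall k, exists y, (p%:Z ^+ k %| a * y ^+ n - b)%Z.
Proof.
move=> pp n0 pn pa pb px k; pose f : {poly int} := a *: 'X^n - b%:P.
have fE y : f.[y] = a * y ^+ n - b.
  by rewrite hornerD hornerN hornerZ hornerXn hornerC.
have npx : ~~ (p%:Z %| x)%Z.
  apply: contra pb => dx.
  by rewrite -(rpredBl b (dvdz_mull a (dvdz_exp n0 dx))).
have [|||y] := @hensel p 0 f x (a * (n%:Z * x ^+ n.-1)) pp _ _ _ k.
- by rewrite fE expr1.
- rewrite derivB derivZ derivXn derivC subr0 hornerZ hornerMn hornerXn expr0 mul1r.
  by rewrite -mulr_natl natz.
- by rewrite !Euclid_dvdzM // Euclid_dvdzX // !negb_or negb_and npx pa dvdzE pn.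
by rewrite fE; exists y.
Qed.

(** At an odd [y] the derivative has valuation 2, so a root modulo 32 is enough. As [q] is 1 or 17
    modulo 32, [y] can be 1 or 3, because 81 is 17 modulo 32. *)
Lemma hensel_fourth_2 (q : nat) : (q = 1 %[mod 16])%N ->
  forall k, exists y, (2%:Z ^+ k %| y ^+ 4 - q%:Z)%Z.
Proof.
move=> q1 k; pose f : {poly int} := 'X^4 - q%:Z%:P.
have fE y : f.[y] = y ^+ 4 - q%:Z.
  by rewrite hornerD hornerN hornerXn hornerC.
have f'E y : f^`().[y] = 2%:Z ^+ 2 * y ^+ 3.
  rewrite derivB derivXn derivC subr0 hornerMn hornerXn; ring.
have [y fy oy] : exists2 y : int, (2%:Z ^+ 5 %| f.[y])%Z & ~~ (2%:Z %| y)%Z.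
  have [q32|q32] : (q = 1 %[mod 32] \/ q = 17 %[mod 32])%N by lia.
    by exists 1 => //; rewrite fE; lia.
  by exists 3 => //; rewrite fE; lia.
have [//||z] := @hensel 2 2 f y (y ^+ 3) _ fy (f'E y) _ k.
  by rewrite Euclid_dvdzX // negb_and oy.
by rewrite fE; exists z.
Qed.

(** A coordinate equal to 1 ensures primitivity, and the points used below satisfy the second
    equation exactly. *)
Lemma UVWZ_p_locally_solvable (p : nat) (q d : int) :
  (forall k, exists U V W Z : int,
    [/\ [|| U == 1, W == 1 | Z == 1],
        (p%:Z ^+ k %| U ^+ 2 - q * W ^+ 2 - d * Z ^+ 2)%Z & U * W = V ^+ 2]) ->
  p_locally_solvable p (UVWZ_system q d).
Proof.
move=> h k _; have [U [V [W [Z [one e1 e2]]]]] := h k.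
pose x (i : 'I_4) := nth 0 [:: U; V; W; Z] i.
exists x; split.
  rewrite /Defs.primitive !big_ord_recl big_ord0 /x /=.
  case/or3P: one => /eqP ->.
  - by rewrite gcd1n.
  - by rewrite gcd1n !gcdn1.
  - by rewrite gcd1n !gcdn1.
have mX i : ('X_i : {mpoly int[4]}).@[x] = x i by rewrite mevalXU.
move=> f; rewrite !inE => /orP[] /eqP ->; apply/eqP.
  rewrite !mevalB !mevalZ !rmorphXn /= !mX /x !inordK //=.
  by move: e1; rewrite eqz_mod_dvd subr0 !dvdzE abszX.
by rewrite mevalB mevalM rmorphXn /= !mX /x !inordK //= e2 subrr.
Qed.

Lemma intr_Fp_eq0 (p : nat) (a : int) :
  prime p -> (a%:~R == 0 :> 'F_p) = (p%:Z %| a)%Z.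
Proof. by move=> pp; rewrite (dvdz_pcharf (pchar_Fp pp)). Qed.

Lemma intr_Fp_surj (p : nat) (x : 'F_p) : exists a : int, x = a%:~R.
Proof. by exists (x : nat)%:Z; rewrite -pmulrn natr_Zp. Qed.

Lemma is_power_modP (n : nat) (a m : int) :
  is_power_mod n a m <-> exists x, (m %| x ^+ n - a)%Z.
Proof.
split=> -[x hx]; exists x; last by apply/eqP; rewrite eqz_mod_dvd.
by rewrite -eqz_mod_dvd hx.
Qed.

Lemma UVWZ_solvable_fourth_power (p : nat) (q d : int) :
  (forall k, exists t, (p%:Z ^+ k %| t ^+ 4 - q)%Z) ->
  p_locally_solvable p (UVWZ_system q d).
Proof.
move=> h; apply: UVWZ_p_locally_solvable => k; have [t ht] := h k.
exists (t ^+ 2), t, 1, 0; split; [by rewrite eqxx orbT | | by rewrite mulr1].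
by rewrite -exprM expr1n expr0n mulr1 mulr0 subr0.
Qed.

Lemma UVWZ_solvable_square (p : nat) (q d : int) :
  (forall k, exists y, (p%:Z ^+ k %| y ^+ 2 - d)%Z) ->
  p_locally_solvable p (UVWZ_system q d).
Proof.
move=> h; apply: UVWZ_p_locally_solvable => k; have [y hy] := h k.
exists y, 0, 0, 1; split; [by rewrite eqxx !orbT | | by rewrite mulr0 expr0n].
by rewrite expr1n mulr1 mulr0 subr0.
Qed.

(** A point from [quartic_points] is lifted by fixing [x] and solving for [z], which requires a
    nonzero quartic value modulo [p]. If the value is zero, [q] is a fourth power modulo [p] and a
    point with [Z = 0] lifts instead. *)
Lemma UVWZ_good_reduction (p : nat) (q d : int) :
  prime p -> odd p -> ~~ (p%:Z %| q)%Z -> ~~ (p%:Z %| d)%Z ->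
  p_locally_solvable p (UVWZ_system q d).
Proof.
move=> pp op pq pd.
have p2 : ~~ (p %| 2)%N.
  by rewrite dvdn_prime2 //; apply: contraTneq op => ->.
have p4 : ~~ (p %| 4)%N by rewrite (Euclid_dvdX 2 2) // andbT.
have p1 : ~~ (p%:Z %| 1)%Z by rewrite dvdz1 absz_nat; apply: contraTneq pp => ->.
have fourth :
    (exists x, (p%:Z %| x ^+ 4 - q)%Z) -> p_locally_solvable p (UVWZ_system q d).
  case=> x px; apply: UVWZ_solvable_fourth_power => k.
  have [//||y] := hensel_power pp _ p4 p1 pq _ k (x := x); first by rewrite mul1r.
  by rewrite mul1r; exists y.
have lift (a z : int) : ~~ (p%:Z %| a)%Z -> (p%:Z %| d * z ^+ 2 - a)%Z ->
    forall k, exists y, (p%:Z ^+ k %| d * y ^+ 2 - a)%Z.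
  by move=> pa pz k; apply: (hensel_power pp _ p2 pd pa pz).
have two : 2%:R != 0 :> 'F_p by rewrite -(dvdn_pcharf (pchar_Fp pp)).
have q0 : q%:~R != 0 :> 'F_p by rewrite intr_Fp_eq0.
have d0 : d%:~R != 0 :> 'F_p by rewrite intr_Fp_eq0.
have [[x ex]|[x [z ez]]|[x [z ez]]] := quartic_points two q0 d0.
- have [a ea] := intr_Fp_surj x; apply: fourth; exists a.
  by rewrite -intr_Fp_eq0 // rmorphB rmorphXn /= -ea ex subrr.
- have [a ea] := intr_Fp_surj x; have [c ec] := intr_Fp_surj z.
  have [dvd|ndvd] := boolP (p%:Z %| 1 - q * a ^+ 4)%Z.
    have e1 : 1 = q%:~R * x ^+ 4.
      apply/eqP; rewrite -subr_eq0 ea -rmorphXn -rmorphM -[1]/(1%:~R) -rmorphB.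
      by rewrite intr_Fp_eq0.
    have [b eb] := intr_Fp_surj x^-1; apply: fourth; exists b.
    rewrite -intr_Fp_eq0 // rmorphB rmorphXn /= -eb exprVn subr_eq0.
    have x0 : x ^+ 4 != 0.
      by apply: contra_eq_neq e1 => ->; rewrite mulr0 oner_neq0.
    by apply/eqP/(mulIf x0); rewrite mulVf.
  apply: UVWZ_p_locally_solvable => k.
  have [|y hy] := lift _ c ndvd _ k.
    rewrite -intr_Fp_eq0 // !(rmorphB, rmorphM, rmorphXn) /= rmorph1.
    by rewrite -ec -ea -ez subrr.
  exists 1, a, (a ^+ 2), y; split; [by rewrite eqxx | | by rewrite mul1r].
  by rewrite expr1n -exprM -opprB rpredN.
have [a ea] := intr_Fp_surj x; have [c ec] := intr_Fp_surj z.
have [dvd|ndvd] := boolP (p%:Z %| a ^+ 4 - q)%Z; first by apply: fourth; exists a.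
apply: UVWZ_p_locally_solvable => k.
have [|y hy] := lift _ c ndvd _ k.
  rewrite -intr_Fp_eq0 // !(rmorphB, rmorphM, rmorphXn) /=.
  by rewrite -ec -ea -ez subrr.
exists (a ^+ 2), a, 1, y; split; [by rewrite eqxx orbT | | by rewrite mulr1].
by rewrite expr1n mulr1 -exprM -opprB rpredN.
Qed.

Lemma UVWZ_everywhere_p_locally_solvable (q : nat) (d : int) :
  prime q -> (q = 1 %[mod 16])%N -> ~~ (q%:Z %| d)%Z ->
  is_power_mod 2 d q%:Z ->
  (forall p : nat, prime p -> odd p -> (p%:Z %| d)%Z -> is_power_mod 4 q%:Z p%:Z) ->
  forall p, prime p -> p_locally_solvable p (UVWZ_system q%:Z d).
Proof.
move=> pq q1 qd d2 q4 p pp.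
have p1 : ~~ (p%:Z %| 1)%Z by rewrite dvdz1 absz_nat; apply: contraTneq pp => ->.
have [op|/negP] := boolP (odd p); last first.
  move=> ep; have -> : p = 2%N by have [] := even_prime pp.
  exact/UVWZ_solvable_fourth_power/hensel_fourth_2.
have p2 : ~~ (p %| 2)%N.
  by rewrite dvdn_prime2 //; apply: contraTneq op => ->.
have [epq|npq] := eqVneq p q.
  apply: UVWZ_solvable_square => k; move/is_power_modP: d2 => [x hx].
  rewrite -epq in qd hx.
  have [//||y] := hensel_power pp _ p2 p1 qd _ k (x := x); first by rewrite mul1r.
  by rewrite mul1r; exists y.
have pqn : ~~ (p%:Z %| q%:Z)%Z by rewrite dvdzE dvdn_prime2.
have [pd|npd] := boolP (p%:Z %| d)%Z; last exact: UVWZ_good_reduction.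
apply: UVWZ_solvable_fourth_power => k; move/is_power_modP: (q4 p pp op pd) => [x hx].
have p4 : ~~ (p %| 4)%N by rewrite (Euclid_dvdX 2 2) // andbT.
have [//||y] := hensel_power pp _ p4 p1 pqn _ k (x := x); first by rewrite mul1r.
by rewrite mul1r; exists y.
Qed.

(** The sign of [d] decides: [W = 0] if [d] is positive, [U = 0] if it is negative, with [V = 0] in
    both cases. *)
Lemma UVWZ_real_solvable (R : realType) (q d : int) :
  0 < q -> d != 0 -> has_nontrivial_solution R (UVWZ_system q d).
Proof.
move=> q0 d0; have dR : d%:~R != 0 :> R by rewrite intr_eq0.
suff [U [W [Z [UW UW0 e]]]] : exists U W Z : R,
    [/\ U * W = 0, (U != 0) || (W != 0) &
       U ^+ 2 - q%:~R * W ^+ 2 = d%:~R * Z ^+ 2].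
  pose x (i : 'I_4) := nth 0 [:: U; 0; W; Z] i.
  exists x; split.
    by case/orP: UW0 => h; [exists (inord 0) | exists (inord 2)]; rewrite /x inordK.
  by apply/UVWZ_system_solution; rewrite /x !inordK //= UW expr0n.
have [dp|dn] := ltP 0 d.
  exists (Num.sqrt d%:~R), 0, 1; split; first by rewrite mulr0.
    by rewrite gt_eqF // sqrtr_gt0 ltr0z.
  by rewrite sqr_sqrtr ?ler0z ?ltW // expr1n expr0n !mulr0n; ring.
exists 0, 1, (Num.sqrt (- q%:~R / d%:~R)); split; first by rewrite mul0r.
  by rewrite oner_neq0 orbT.
rewrite sqr_sqrtr; first by field.
rewrite mulNr -mulrN -invrN divr_ge0 ?ler0z ?(ltW q0) // oppr_ge0.
by rewrite lerz0.
Qed.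

(** * Global insolubility *)

(** After division by [gcdz m z], the cofactor [a] of [m] is coprime to that of [z]; hence [a ^+ 2]
    divides [d] and [a] is a unit. *)
Lemma square_free_dvd_sqr (d m z : int) :
  d != 0 -> square_free d -> (m ^+ 2 %| d * z ^+ 2)%Z -> (m %| z)%Z.
Proof.
move=> d0 sd; have [->|m0] := eqVneq m 0.
  by rewrite expr0n !dvd0z mulf_eq0 (negbTE d0) expf_eq0.
have g0 : gcdz m z != 0 by rewrite gcdz_eq0 (negbTE m0).
have /dvdzP[a ea] := dvdz_gcdl m z; have /dvdzP[b eb] := dvdz_gcdr m z.
have cab : coprimez a b.
  rewrite /coprimez -(inj_eq (mulIf g0)) mul1r.
  have -> : gcdz m z = `|gcdz m z|%:Z by [].
  by rewrite mulz_gcdl -ea -eb.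
rewrite {1}ea {1}eb !exprMn mulrA dvdz_mul2r ?expf_neq0 //.
rewrite Gauss_dvdzl; last by rewrite coprimez_pexpl ?coprimez_pexpr.
by move=> /sd a1; rewrite ea dvdzE abszM a1 mul1n dvdn_gcdr.
Qed.

Lemma is_square_natr (q n : nat) : prime q ->
  (forall p, prime p -> (p %| n)%N -> is_square (p%:R : 'F_q)) ->
  is_square (n%:R : 'F_q).
Proof.
move=> pq; elim/ltn_ind: n => n IH h.
have [n1|n1] := leqP n 1; first by
  case: n n1 {IH h} => [|[]] // _; rewrite ?is_square0 ?is_square1.
have /dvdnP[m em] := pdiv_dvd n.
have pp := pdiv_prime n1.
rewrite em natrM; apply: is_squareM; last by rewrite h ?pdiv_dvd.
apply: IH => [|p pr dp]; last by apply: h => //; rewrite em dvdn_mulr.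
rewrite em ltn_Pmulr ?prime_gt1 //.
by case: m em => // em; rewrite em in n1.
Qed.

(** Modulo [q] the equation reads [u ^+ 4 = d * z ^+ 2], so once [z] is a nonzero square [y ^+ 2]
    there, [d] is the fourth power of [u / y]. *)
Lemma quartic_coprime_fourth_power (q : nat) (d u w z : int) :
  prime q -> (q = 1 %[mod 8])%N -> ~~ (q%:Z %| d)%Z -> coprimez u w ->
  u ^+ 4 - q%:Z * w ^+ 4 = d * z ^+ 2 -> is_power_mod 4 d q%:Z.
Proof.
move=> pq q1 qd cuw e.
have q14 : (q = 1 %[mod 4])%N by lia.
have ncop (p : nat) : prime p -> (p%:Z %| u)%Z -> (p%:Z %| w)%Z -> False.
  move=> pp du dw; have : (p%:Z %| gcdz u w)%Z by rewrite dvdz_gcd du.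
  rewrite (eqP cuw) dvdz1 absz_nat => /eqP p1; by rewrite p1 in pp.
(* If [q] divides [u], it divides [z]; then its square divides [q * w ^+ 4], so [q] divides [w],
   against coprimality. *)
have qu : ~~ (q%:Z %| u)%Z.
  apply/negP => qu; apply: (ncop q pq qu).
  have qz : (q%:Z %| z)%Z.
    have : (q%:Z %| d * z ^+ 2)%Z.
      by rewrite -e rpredB ?dvdz_mulr // dvdz_exp.
    by rewrite Euclid_dvdzM // (negbTE qd) Euclid_dvdzX // andbT.
  have /dvdzP[u' eu] := qu; have /dvdzP[z' ez] := qz.
  have q0 : q%:Z != 0 by case: (q) pq.
  have : w ^+ 4 = q%:Z * (q%:Z ^+ 2 * u' ^+ 4 - d * z' ^+ 2).
    apply: (mulfI q0); have -> : q%:Z * w ^+ 4 = u ^+ 4 - d * z ^+ 2 by rewrite -e; ring.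
    by rewrite eu ez; ring.
  move=> ew; have : (q%:Z %| w ^+ 4)%Z by rewrite ew dvdz_mulr.
  by rewrite Euclid_dvdzX // andbT.
have qz : ~~ (q%:Z %| z)%Z.
  apply: contra qu => qz; have : (q%:Z %| u ^+ 4)%Z.
    have -> : u ^+ 4 = d * z ^+ 2 + q%:Z * w ^+ 4 by rewrite -e; ring.
    by rewrite rpredD ?[(_ %| _ * w ^+ 4)%Z]dvdz_mulr // dvdz_mull // dvdz_exp.
  by rewrite Euclid_dvdzX // andbT.
have sz : is_square (z%:~R : 'F_q).
  have sn : is_square (`|z|%N%:R : 'F_q).
    apply: is_square_natr => // p pp pz.
    have [op|/negP] := boolP (odd p); last first.
      move=> ep; have -> : p = 2%N by have [] := even_prime pp.
      exact: is_square_two.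
    have pzz : (p%:Z %| z)%Z by rewrite dvdzE.
    have npq : p != q by apply: contraNneq qz => <-.
    have euw : u ^+ 4 = d * z ^+ 2 + q%:Z * w ^+ 4 by rewrite -e; ring.
    have pw : ~~ (p%:Z %| w)%Z.
      apply/negP => pw; apply: (ncop p pp _ pw).
      have : (p%:Z %| u ^+ 4)%Z.
        by rewrite euw rpredD // dvdz_mull // dvdz_exp.
      by rewrite Euclid_dvdzX // andbT.
    (* As [p] divides [z], modulo [p] the number [q] is the square of [u ^+ 2 / w ^+ 2]. *)
    apply: quadratic_reciprocity_mod4 => //; apply/is_squareP.
    have w0 : w%:~R != 0 :> 'F_p by rewrite intr_Fp_eq0.
    exists (u%:~R ^+ 2 / w%:~R ^+ 2); apply: (mulIf (expf_neq0 4 w0)).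
    have z0 : z%:~R = 0 :> 'F_p by apply/eqP; rewrite intr_Fp_eq0.
    have := congr1 (fun x : int => x%:~R : 'F_p) euw.
    rewrite !(rmorphXn, rmorphD, rmorphM) /= z0 expr0n mulr0 add0r => <-.
    by field.
  have [z0|z0] := leP 0 z; first by rewrite -(gez0_abs z0) -pmulrn.
  rewrite -[z]opprK -(ltz0_abs z0) rmorphN /= -pmulrn -mulN1r.
  by rewrite is_squareM // is_square_opp1_mod4.
have /is_squareP[y ey] := sz; have [a ea] := intr_Fp_surj (u%:~R / y).
apply/is_power_modP; exists a.
have y0 : y != 0.
  by apply: contraNneq qz => y0; rewrite -intr_Fp_eq0 // ey y0 expr0n.
rewrite -intr_Fp_eq0 // rmorphB rmorphXn /= -ea subr_eq0 expr_div_n.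
have := congr1 (fun x : int => x%:~R : 'F_q) e.
rewrite !(rmorphXn, rmorphB, rmorphM) /= -pmulrn pchar_Fp_0 // mul0r subr0 => ->.
by rewrite ey -exprM mulfK ?expf_neq0.
Qed.

Lemma UVWZ_not_globally_solvable (q : nat) (d : int) :
  prime q -> (q = 1 %[mod 8])%N -> d != 0 -> square_free d -> ~~ (q%:Z %| d)%Z ->
  ~ is_power_mod 4 d q%:Z -> ~ globally_solvable (UVWZ_system q%:Z d).
Proof.
move=> pq q1 d0 sd qd nd4 [x [ntx /UVWZ_system_solution]].
have : forall i : 'I_4, [\/ i = inord 0, i = inord 1, i = inord 2 | i = inord 3].
  move=> i; have : inord i = i := inord_val i.
  by case: i => [[|[|[|[|i]]]]] //= ? <-;
    [apply: Or41|apply: Or42|apply: Or43|apply: Or44].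
move=> hI [].
have : [|| x (inord 0) != 0, x (inord 1) != 0, x (inord 2) != 0 | x (inord 3) != 0].
  by case: ntx => i; case: (hI i) => -> ->; rewrite ?orbT.
rewrite !intz.
move: (x (inord 0)) (x (inord 1)) (x (inord 2)) (x (inord 3)) => U V W Z nt e UW.
have q0 : q%:Z != 0 by case: (q) pq.
(* If [U = 0], then [V = 0]; unless [W = 0] too, square-freeness gives [Z = k * W] and
   [- q = d * k ^+ 2], which forces [q] to divide [k] and its own square to divide it. *)
have [U0|U0] := eqVneq U 0.
  have V0 : V = 0.
    have : V ^+ 2 == 0 by rewrite -UW U0 mul0r.
    by rewrite expf_eq0 => /eqP.
  have [W0|W0] := eqVneq W 0.
    move: nt e; rewrite U0 V0 W0 !eqxx /= expr0n mulr0 subr0 => Z0 /esym/eqP.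
    by rewrite mulf_eq0 expf_eq0 (negbTE d0) (negbTE Z0).
  have eW : d * Z ^+ 2 = - q%:Z * W ^+ 2 by rewrite -e U0; ring.
  have /dvdzP[k ek] : (W %| Z)%Z.
    by apply: (square_free_dvd_sqr d0 sd); rewrite eW dvdz_mull.
  have eq : - q%:Z = d * k ^+ 2.
    by apply: (mulIf (expf_neq0 2 W0)); rewrite -eW ek; ring.
  have qk : (q%:Z %| k)%Z.
    have : (q%:Z %| d * k ^+ 2)%Z by rewrite -eq rpredN.
    by rewrite Euclid_dvdzM // (negbTE qd) Euclid_dvdzX // andbT.
  have : (q%:Z * q%:Z %| q%:Z * 1)%Z.
    by rewrite mulr1 -rpredN eq dvdz_mull // -expr2 dvdz_exp2r.
  rewrite dvdz_mul2l // dvdz1 absz_nat => /eqP q11.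
  by rewrite q11 in pq.
apply: nd4; pose g := gcdz U V.
have g0 : g != 0 by rewrite gcdz_eq0 (negbTE U0).
have /dvdzP[u eu] := dvdz_gcdl U V; have /dvdzP[v ev] := dvdz_gcdr U V.
rewrite -/g in eu ev.
have cuv : coprimez u v.
  rewrite /coprimez -(inj_eq (mulIf g0)) mul1r.
  have -> : g = `|g|%:Z by [].
  by rewrite mulz_gcdl absz_nat -eu -ev.
have e4 : U ^+ 4 - q%:Z * V ^+ 4 = d * (U * Z) ^+ 2.
  have -> : V ^+ 4 = (U * W) ^+ 2 by rewrite UW -exprM.
  have -> : d * (U * Z) ^+ 2 = U ^+ 2 * (d * Z ^+ 2) by ring.
  by rewrite -e; ring.
have eg : g ^+ 4 * (u ^+ 4 - q%:Z * v ^+ 4) = d * (U * Z) ^+ 2.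
  by rewrite -e4 eu ev; ring.
(* Square-freeness of [d] lets the factor [g ^+ 4] be cancelled, leaving the quartic equation for
   the coprime pair [u], [v]. *)
have /dvdzP[z ez] : (g ^+ 2 %| U * Z)%Z.
  by apply: (square_free_dvd_sqr d0 sd); rewrite -eg -exprM dvdz_mulr.
apply: (quartic_coprime_fourth_power pq q1 qd cuv (z := z)).
by apply: (mulfI (expf_neq0 4 g0)); rewrite eg ez; ring.
Qed.

Unset Implicit Arguments.

Theorem theorem4 (R : realType) (q : nat) (d : int)
    (q_prime : prime q) (q_mod16 : (q = 1 %[mod 16])%N)
    (d_neq0 : d != 0) (d_sqfree : square_free d) (q_ndvd_d : ~~ (q%:Z %| d)%Z)
    (d_square : is_power_mod 2 d q%:Z)
    (d_not_fourth : ~ is_power_mod 4 d q%:Z)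
    (q_fourth : forall p : nat, prime p -> odd p -> (p%:Z %| d)%Z ->
       is_power_mod 4 q%:Z p%:Z) :
  locally_solvable R (UVWZ_system q%:Z d) /\
  ~ globally_solvable (UVWZ_system q%:Z d).
Proof.
have q_mod8 : (q = 1 %[mod 8])%N by lia.
split; last exact: UVWZ_not_globally_solvable.
split; first exact: UVWZ_everywhere_p_locally_solvable.
by apply: UVWZ_real_solvable; rewrite // ltz_nat prime_gt0.
Qed.
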